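(* Let $R$ be a commutative ring with identity, $A$ a commutative $R$-algebra with identity which is a domain, $f$ an averaging operator on $A$, and $A_f=(A,[,]_f)$ the Lie algebra with bracket $[x,y]_f=xf(y)-yf(x)$. (i) If $\ker(f)=0$, then $Nr(A_f)=A_f$. (ii) If $\ker(f)\neq0$, then $Nr(A_f)=\ker(f)$.
   Context: An averaging operator on $A$ is an $R$-module endomorphism $f:A\to A$ with $f(xf(y))=f(x)f(y)$ for all $x,y\in A$; then $[,]_f$ is a Lie bracket on the $R$-module $A$. For a Lie algebra $L$: $L^1=L$, $L^k=[L^{k-1},L]$ for $k>1$; $L$ is nilpotent if $L^k=0$ for some $k>1$. The nilpotent radical $Nr(L)$ is the unique maximal nilpotent ideal (if any) of $L$. *)

(* Defs.v *)
From HB Require Import structures.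
From mathcomp Require Import all_boot all_order all_algebra.
From mathcomp Require Import boolp classical_sets.
From mathcomp Require Import ring.

Set Implicit Arguments.
Unset Strict Implicit.
Unset Printing Implicit Defensive.

Import GRing.Theory.
Local Open Scope classical_set_scope.
Local Open Scope ring_scope.

HB.mixin Record Lmodule_isLieAlgebra (R : comPzRingType) L
    of GRing.Lmodule R L := {
  lie : L -> L -> L;
  lie_linearr : forall x : L, linear (lie x);
  lie_linearl : forall y : L, linear (lie^~ y);
  liexx : forall x : L, lie x x = 0;
  lie_jacobi : forall x y z : L,
    lie (lie x y) z + lie (lie y z) x + lie (lie z x) y = 0
}.

#[short(type="lieAlgType")]
HB.structure Definition LieAlgebra (R : comPzRingType) :=
  {L of GRing.Lmodule R L & Lmodule_isLieAlgebra R L}.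

Section LieAlgebraTheory.
Variables (R : comPzRingType) (L : lieAlgType R).
Implicit Types I J : set L.

Definition submodule I := submod_closed (mem I).

(* [I, J] is the R-submodule generated by the brackets, not merely the set of
   brackets. *)
Definition lie_commutator I J : set L :=
  smallest submodule [set lie x y | x in I & y in J].

Definition lie_ideal I :=
  submodule I /\ forall x y : L, I x -> I (lie x y).

(* The k-th term I^k of the lower central series of I, viewed as a Lie algebra
   in its own right. Indexing starts at k = 1 (I^1 = I), so k = 0 is junk. *)
Definition lower_central I (k : nat) : set L :=
  iter k.-1 (fun J => lie_commutator J I) I.

Definition lie_nilpotent I :=
  exists k : nat, (1 < k)%N /\ lower_central I k = [set 0].

Definition nilpotent_ideal I := lie_ideal I /\ lie_nilpotent I.

Definition maximal_nilpotent_ideal I :=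
  nilpotent_ideal I /\
  forall J, nilpotent_ideal J -> I `<=` J -> J = I.

(* The nilpotent radical need not exist, so "Nr(L) = N" is a relation. *)
Definition is_nilpotent_radical (N : set L) :=
  unique maximal_nilpotent_ideal N.

End LieAlgebraTheory.

Definition averaging (R : comPzRingType) (A : comAlgType R) (f : A -> A) :=
  forall x y : A, f (x * f y) = f x * f y.

(* A_f: the R-module A, as a copy of A that carries the bracket [,]_f. *)
Definition avg_lie (R : comPzRingType) (A : comAlgType R)
  (f : {linear A -> A}) (hf : averaging f) : Type := A.

Section AveragingLie.
Variables (R : comPzRingType) (A : comAlgType R).
Variables (f : {linear A -> A}) (hf : averaging f).

HB.instance Definition _ := GRing.Lmodule.copy (avg_lie hf) A.

Definition avg_bracket (x y : A) : A := x * f y - y * f x.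

Fact avg_bracket_linearr (x : A) : linear (avg_bracket x).
Proof.
move=> a u v; rewrite /avg_bracket linearP mulrDr mulrDl -scalerAr -scalerAl.
by rewrite opprD addrACA scalerBr.
Qed.

Fact avg_bracket_linearl (y : A) : linear (avg_bracket^~ y).
Proof.
move=> a u v; rewrite /avg_bracket linearP mulrDr mulrDl -scalerAr -scalerAl.
by rewrite opprD addrACA scalerBr.
Qed.

Fact avg_bracketxx (x : A) : avg_bracket x x = 0.
Proof. exact: subrr. Qed.

Fact avg_bracket_ker (x y : A) : f (avg_bracket x y) = 0.
Proof. by rewrite /avg_bracket linearB !hf mulrC subrr. Qed.

Fact avg_bracket_jacobi (x y z : A) :
  avg_bracket (avg_bracket x y) z + avg_bracket (avg_bracket y z) x
    + avg_bracket (avg_bracket z x) y = 0.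
Proof.
have brE u v w : avg_bracket (avg_bracket u v) w = avg_bracket u v * f w.
  by rewrite {1}/avg_bracket avg_bracket_ker mulr0 subr0.
by rewrite !brE /avg_bracket; ring.
Qed.

HB.instance Definition _ := Lmodule_isLieAlgebra.Build R (avg_lie hf)
  avg_bracket_linearr avg_bracket_linearl avg_bracketxx avg_bracket_jacobi.

End AveragingLie.

(* Main.v *)
(* The image of the bracket lies in ker f, so ker f is an abelian ideal, and
   A_f itself is abelian when ker f = 0. If 0 <> k in ker f and x lies in an
   ideal I, then bracketing k repeatedly with x shows that k f(x)^n lies in the
   n-th term of the lower central series of I; since A is a domain, nilpotency
   of I forces f(x) = 0, hence every nilpotent ideal is contained in ker f. *)
Require Import Defs.
From mathcomp Require Import all_boot all_order all_algebra.
From mathcomp Require Import boolp classical_sets.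

Set Implicit Arguments.
Unset Strict Implicit.
Unset Printing Implicit Defensive.

Import GRing.Theory.
Local Open Scope classical_set_scope.
Local Open Scope ring_scope.

Section LieAlgebra.
Variables (R : comPzRingType) (L : lieAlgType R).
Implicit Types I J N : set L.

(** Passes from the boolean predicate [mem I], required by [submod_closed], to membership in [I] as
    a proposition. *)
Lemma submoduleP I :
  submodule I <-> I 0 /\ forall (a : R) (u v : L), I u -> I v -> I (a *: u + v).
Proof.
split=> -[I0 Ilin]; split.
- by rewrite -in_setE.
- by move=> a u v Iu Iv; rewrite -in_setE; apply: Ilin; apply/mem_set.
- exact/mem_set.
- by move=> a u v /set_mem Iu /set_mem Iv; apply/mem_set/Ilin.
Qed.

Lemma submodule_opp I (x : L) : submodule I -> I x -> I (- x).
Proof.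
move=> /submoduleP[I0 Ilin] Ix.
by rewrite -scaleN1r -[_ *: x]addr0; apply: Ilin.
Qed.

Lemma lie_ideal_setT : lie_ideal [set: L].
Proof. by split => //; apply/submoduleP. Qed.

Lemma lie_commutator_lie I J (x y : L) :
  I x -> J y -> lie_commutator I J (lie x y).
Proof. by move=> Ix Jy; apply: sub_gen_smallest; exists x => //; exists y. Qed.

Lemma lower_centralS I k :
  (0 < k)%N -> lower_central I k.+1 = lie_commutator (lower_central I k) I.
Proof. by case: k. Qed.

Lemma abelian_lie_nilpotent I :
  (forall x y : L, I x -> I y -> lie x y = 0) -> lie_nilpotent I.
Proof.
move=> abI; exists 2; split=> //; rewrite lower_centralS //.
apply/seteqP; split=> [z|z ->].
  (* [[set 0]] is itself a submodule containing all the brackets, so the smallest such submodule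
     lies inside it. *)
  apply; split.
    by apply/submoduleP; split=> // a u v -> ->; rewrite scaler0 addr0.
  by move=> _ [x Ix [y Iy <-]]; exact: abI.
by move=> M [/submoduleP[]].
Qed.

(** Any maximal nilpotent ideal lies in [N], hence equals [N] by its own maximality; this gives
    uniqueness. *)
Lemma greatest_nilpotent_ideal N :
  nilpotent_ideal N -> (forall I, nilpotent_ideal I -> I `<=` N) ->
  is_nilpotent_radical N.
Proof.
move=> nilN leN; split=> [|I [nilI maxI]].
  by split=> // I nilI NI; apply/seteqP; split=> //; exact: leN.
by apply: maxI => //; exact: leN.
Qed.

End LieAlgebra.

Section Averaging.
Variables (R : comPzRingType) (A : comAlgType R).
Variables (f : {linear A -> A}) (hf : averaging f).

Let L : lieAlgType R := avg_lie hf.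
Let K : set L := f @^-1` [set 0].

Lemma avg_lieE (x y : L) : lie x y = (x : A) * f y - (y : A) * f x :> A.
Proof. by []. Qed.

Lemma ker_lie_ideal : lie_ideal K.
Proof.
split; last by move=> x y _; exact: avg_bracket_ker.
apply/submoduleP; split; first exact: (linear0 f).
by move=> a u v fu fv; rewrite /K/= linearP fu fv scaler0 addr0.
Qed.

Lemma ker_lie_nilpotent : lie_nilpotent K.
Proof.
apply: abelian_lie_nilpotent => x y fx fy.
by rewrite avg_lieE fx fy !mulr0 subr0.
Qed.

Lemma lower_central_avg (I : set L) (k x : A) (n : nat) :
  lie_ideal I -> f k = 0 -> I x -> lower_central I n.+1 (k * f x ^+ n.+1).
Proof.
move=> [subI idI] fk Ix; elim: n => [|n IHn].
  (* The first term is [I] itself. Since [k] need not lie in [I], the bracket is taken with [x] on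
     the left, at the cost of a sign. *)
  rewrite expr1; have -> : k * f x = - lie (x : L) (k : L) :> A.
    by rewrite avg_lieE fk mulr0 sub0r opprK.
  by apply: submodule_opp => //; exact: idI.
rewrite lower_centralS //.
have -> : k * f x ^+ n.+2 = lie (k * f x ^+ n.+1 : L) (x : L) :> A.
  (* Averaging pulls each factor [f x] out of [f], so the products stay in the kernel and one half
     of the bracket with [x] vanishes. *)
  have fkx m : f (k * f x ^+ m) = 0.
    by elim: m => [|m IHm]; rewrite ?mulr1 // exprSr mulrA hf IHm mul0r.
  by rewrite avg_lieE fkx mulr0 subr0 -mulrA -exprSr.
exact: lie_commutator_lie.
Qed.

Lemma nilpotent_ideal_sub_ker (domA : GRing.integral_domain_axiom A) (k : A)
    (I : set L) :
  k != 0 -> f k = 0 -> nilpotent_ideal I -> I `<=` K.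
Proof.
move=> k0 fk [idI [[|n] [n_gt0 In0]]] x Ix; first by [].
have := lower_central_avg n idI fk Ix; rewrite In0 => /= /domA.
rewrite (negbTE k0) /= => fxn0; apply/eqP.
(* [domA] strips one factor [f x] at a time from the vanishing power. *)
elim: n.+1 fxn0 => [|m IHm]; first by rewrite oner_eq0.
by rewrite exprS => /eqP/domA/orP[|/IHm].
Qed.

End Averaging.

Theorem proposition5p4 (R : comPzRingType) (A : comAlgType R)
    (domA : GRing.integral_domain_axiom A)
    (f : {linear A -> A}) (hf : averaging f) :
  (f @^-1` [set 0] = [set 0] ->
     is_nilpotent_radical [set: avg_lie hf]) /\
  (f @^-1` [set 0] <> [set 0] ->
     is_nilpotent_radical (f @^-1` [set 0] : set (avg_lie hf))).
Proof.
split=> kerf; apply: greatest_nilpotent_ideal => //.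
- split; first exact: lie_ideal_setT.
  apply: abelian_lie_nilpotent => x y _ _.
  have : (f @^-1` [set 0]) (lie x y : A) by exact: avg_bracket_ker.
  by rewrite kerf.
- by split; [exact: ker_lie_ideal | exact: ker_lie_nilpotent].
(* The kernel always contains [0], so if it had no nonzero element it would equal [[set 0]]. *)
- have [k [fk k0]] : exists k : A, f k = 0 /\ k != 0.
    apply: contra_notP kerf => nok; apply/seteqP; split=> [k fk|k ->]; last first.
      exact: linear0.
    by apply: contra_notP nok => /eqP k0; exists k.
  by move=> I; exact: (nilpotent_ideal_sub_ker domA k0 fk).
Qed.
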